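(* The Consistency Index $CI$ is strongly upper bounded: for all $m\ge 2$, all pairwise comparison matrices $\mathbf{A}_1,\ldots,\mathbf{A}_m\in\mathcal{A}$ of the same order and all $\boldsymbol{\lambda}\in\mathcal{L}_m$, $$CI(\mathbf{A}^{\star})\le \sum_{h=1}^m\lambda_h\, CI(\mathbf{A}_h).$$
   Context: A pairwise comparison matrix of order $n$ is a real $n\times n$ matrix $\mathbf{A}=(a_{ij})$ with $a_{ij}>0$ and $a_{ij}a_{ji}=1$ for all $i,j$. $\mathcal{A}$ is the set of all pairwise comparison matrices of all orders $n>2$. $\mathcal{L}_m=\{(\lambda_1,\ldots,\lambda_m): \lambda_h\ge 0\ \forall h,\ \sum_{h=1}^m\lambda_h=1\}$. Given $\mathbf{A}_h=(a_{ij}^{(h)})_{n\times n}\in\mathcal{A}$, $h=1,\ldots,m$ (same order $n$), and $\boldsymbol{\lambda}\in\mathcal{L}_m$, the aggregated matrix $\mathbf{A}^{\star}=(a_{ij}^{\star})_{n\times n}$ is $a_{ij}^{\star}=\prod_{h=1}^m (a_{ij}^{(h)})^{\lambda_h}$. For $\mathbf{A}\in\mathcal{A}$ of order $n$, $CI(\mathbf{A})=\dfrac{\lambda_{\max}(\mathbf{A})-n}{n-1}$, where $\lambda_{\max}(\mathbf{A})$ is the maximum (Perron) eigenvalue of $\mathbf{A}$, equal to its spectral radius. *)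

(* Defs.v *)
(* Written over MathComp and MathComp-Analysis, for an arbitrary realType. *)
From HB Require Import structures.
From mathcomp Require Import all_boot all_order all_algebra.
From mathcomp Require Import all_classical all_reals all_analysis.
Set Implicit Arguments.
Unset Strict Implicit.
Unset Printing Implicit Defensive.
Import Order.TTheory GRing.Theory Num.Theory.
Local Open Scope classical_set_scope.
Local Open Scope ring_scope.

Definition pairwise_comparison (R : realType) (n : nat) (A : 'M[R]_n) : Prop :=
  forall i j, 0 < A i j /\ A i j * A j i = 1.

Definition weight_vector (R : realType) (m : nat) (lambda : 'I_m -> R) : Prop :=
  (forall h, 0 <= lambda h) /\ \sum_(h < m) lambda h = 1.

Definition aggregate (R : realType) (m n : nat)
    (A : 'I_m -> 'M[R]_n) (lambda : 'I_m -> R) : 'M[R]_n :=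
  \matrix_(i, j) \prod_(h < m) (A h i j `^ lambda h).

(* The set of real eigenvalues is finite, and by Perron's theorem it is
   nonempty for an entrywise positive matrix of order n > 0; in that case the
   supremum is a maximum, namely the Perron root, which is also the spectral
   radius. [eigenvalue] uses row eigenvectors, which yield the same
   eigenvalues as column ones. *)
Definition lambda_max (R : realType) (n : nat) (A : 'M[R]_n) : R :=
  sup [set x : R | eigenvalue A x].

Definition CI (R : realType) (n : nat) (A : 'M[R]_n) : R :=
  (lambda_max A - n%:R) / (n%:R - 1).

(* Main.v *)
(* Entrywise nonnegative matrices are handled through positive vectors v with
   A v <= r v.  Pairing such a v with the absolute value of a left eigenvector
   shows that r bounds every real eigenvalue.  Conversely the infimum of all
   admissible r is an eigenvalue: otherwise r y - A y = 1 is solvable, a minimum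
   principle makes y positive, and y shows that r - e is admissible for some
   e > 0.  So each A_h admits such a v_h with r as close
   as desired to its Perron root.  The weighted geometric mean of the v_h is
   then admissible for the aggregated matrix: by weighted AM-GM,
     prod_h (a^h_ij v_hj / v_hi)^lambda_h <= sum_h lambda_h a^h_ij v_hj / v_hi,
   and summing over j gives the bound sum_h lambda_h r_h. *)
Require Import Defs.
From HB Require Import structures.
From mathcomp Require Import all_boot all_order all_algebra.
From mathcomp Require Import all_classical all_reals all_analysis.
From mathcomp Require Import ring lra.
Set Implicit Arguments.
Unset Strict Implicit.
Import Order.TTheory GRing.Theory Num.Theory.
Local Open Scope ring_scope.

Definition subinvariant (R : realType) (n : nat) (A : 'M[R]_n) (r : R)
    (v : 'I_n -> R) : Prop :=
  forall i, 0 < v i /\ \sum_j A i j * v j <= r * v i.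

Lemma eigenvalue_le_subinvariant (R : realType) (n : nat) (A : 'M[R]_n)
    (r x : R) (v : 'I_n -> R) :
  (forall i j, 0 <= A i j) -> subinvariant A r v -> eigenvalue A x -> x <= r.
Proof.
move=> A0 Av /eigenvalueP[u uA u0].
have [k uk] : exists k, u 0 k != 0.
  apply/existsP; rewrite -negb_forall; apply: contra u0 => /forallP u0.
  by apply/eqP/rowP => k; rewrite mxE; apply/eqP.
have pos : 0 < \sum_j `|u 0 j| * v j.
  rewrite (bigD1 k) //= ltr_pwDl ?mulr_gt0 ?normr_gt0 //; first by case: (Av k).
  by apply: sumr_ge0 => j _; rewrite mulr_ge0 // ltW //; case: (Av j).
rewrite -(ler_pM2r pos) mulr_sumr.
apply: (@le_trans _ _ (\sum_j (\sum_i `|u 0 i| * A i j) * v j)).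
  apply: ler_sum => j _; rewrite mulrA ler_wpM2r //.
    by rewrite ltW //; case: (Av j).
  apply: (@le_trans _ _ (`|x * u 0 j|)).
    by rewrite normrM ler_wpM2r // ler_norm.
  have -> : x * u 0 j = \sum_i u 0 i * A i j.
    by move/rowP: uA => /(_ j); rewrite !mxE.
  apply: le_trans (ler_norm_sum _ _ _) _.
  by apply: ler_sum => i _; rewrite normrM (ger0_norm (A0 i j)).
under eq_bigr do rewrite mulr_suml.
rewrite exchange_big /= mulr_sumr; apply: ler_sum => i _.
under eq_bigr do rewrite -mulrA.
by rewrite -mulr_sumr mulrCA ler_wpM2l //; case: (Av i).
Qed.

(** If the least ratio [x i / v i] were some [t < 0], then [x - t v] would be nonnegative and vanish
    at the minimizing [i]; applying [A] there gives [0 <= t (r v_i - (A v)_i)], whose right side is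
    negative since [s < r]. *)
Lemma subinvariant_min_principle (R : realType) (n : nat) (A : 'M[R]_n)
    (r s : R) (v x : 'I_n -> R) :
  (forall i j, 0 <= A i j) -> subinvariant A s v -> s < r ->
  (forall i, \sum_j A i j * x j <= r * x i) -> forall i, 0 <= x i.
Proof.
move=> A0 Av sr Ax i0; rewrite leNgt; apply/negP => xi0.
pose q i := x i / v i.
have v0 j : 0 < v j by case: (Av j).
have [i _ imin] := @Order.TotalTheory.arg_minP _ R _ i0 xpredT q isT.
set t := q i in imin.
have t0 : t < 0.
  by apply: (le_lt_trans (imin i0 isT)); rewrite /q pmulr_llt0 ?invr_gt0.
have z0 j : 0 <= x j - t * v j.
  by rewrite subr_ge0 -ler_pdivlMr // imin.
have xi : x i = t * v i by rewrite /t /q divfK // gt_eqF.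
have h : 0 <= \sum_j A i j * (x j - t * v j).
  by apply: sumr_ge0 => j _; rewrite mulr_ge0.
have e : \sum_j A i j * (x j - t * v j)
       = \sum_j A i j * x j - t * \sum_j A i j * v j.
  by rewrite mulr_sumr -sumrB; apply: eq_bigr => j _; ring.
have h1 := Ax i; have [vi h2] := Av i.
rewrite e in h; rewrite xi in h1.
have h3 : \sum_j A i j * v j < r * v i.
  by apply: (le_lt_trans h2); rewrite ltr_pM2r.
have h4 : t * (r * v i) < t * \sum_j A i j * v j by rewrite ltr_nM2l.
by move: h h1 h4; lra.
Qed.

Lemma inf_subinvariant_eigenvalue (R : realType) (n : nat) (A : 'M[R]_n) :
  (0 < n)%N -> (forall i j, 0 <= A i j) ->
  let S := [set r | exists v, subinvariant A r v]%classic in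
  has_inf S /\ eigenvalue A (inf S).
Proof.
move=> n0 A0 S; pose i0 := Ordinal n0.
have S0 : lbound S 0.
  move=> r [v Av]; have [vi Avi] := Av i0.
  rewrite -(pmulr_lge0 r vi); apply: le_trans Avi.
  by apply: sumr_ge0 => j _; rewrite mulr_ge0 // ltW //; case: (Av j).
have hS : has_inf S.
  split; last by exists 0.
  (* The sum of all entries dominates every row sum. *)
  exists (\sum_i \sum_j A i j), (fun=> 1) => i; split=> //.
  rewrite mulr1 [leRHS](bigD1 i) //=.
  under eq_bigr do rewrite mulr1.
  by rewrite lerDl; do 2?[apply: sumr_ge0 => ? _].
split=> //; set r := inf S; rewrite /eigenvalue /eigenspace kermx_eq0.
apply/negP; rewrite row_free_unit => Bu.
have [yv hy] : exists yv : 'cV[R]_n, (A - r%:M) *m yv = - const_mx 1.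
  exists (- (invmx (A - r%:M) *m const_mx 1)).
  by rewrite mulmxN mulmxA mulmxV // mul1mx.
pose y i := yv i 0.
have Ay i : \sum_j A i j * y j = r * y i - 1.
  move/matrixP: hy => /(_ i 0); rewrite mulmxBl mul_scalar_mx !mxE => h.
  by rewrite -[LHS](subrK (r * y i)) h addrC.
(* Since [M^-1 * |y i| <= 1], the constant 1 in [A y = r y - 1] can absorb a shift of [r] by [M^-1]
   in either direction. *)
pose M := 1 + \sum_i `|y i|.
have yM i : `|y i| <= M.
  rewrite /M (bigD1 i) //= addrCA lerDl addr_ge0 //.
  by apply: sumr_ge0.
have M0 : 0 < M by rewrite ltr_pwDl // sumr_ge0.
have MV0 : 0 < M^-1 by rewrite invr_gt0.
(* The infimum [r] may not be attained, so the minimum principle is applied at [r + M^-1], strictly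
   above some admissible [s]. *)
have y0 i : 0 <= y i.
  have [s [v Av] sr] := inf_adherent MV0 hS.
  apply: (subinvariant_min_principle (r := r + M^-1)) A0 Av sr _ i => i.
  have : - 1 <= M^-1 * y i.
    rewrite mulrC ler_pdivlMr // mulN1r.
    by have := yM i; rewrite ler_norml => /andP[].
  by rewrite Ay; lra.
have ypos i : 0 < y i.
  rewrite lt_neqAle y0 andbT eq_sym; apply/eqP => yi.
  have := Ay i; rewrite yi mulr0 => h.
  have : 0 <= \sum_j A i j * y j by apply: sumr_ge0 => j _; rewrite mulr_ge0.
  by rewrite h; lra.
have : S (r - M^-1).
  exists y => i; split=> //; rewrite Ay.
  have : M^-1 * y i <= 1.
    by rewrite mulrC ler_pdivrMr // mul1r (le_trans (ler_norm _)).
  by lra.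
move=> /(ge_inf (proj2 hS)); rewrite -/r; lra.
Qed.

Lemma lambda_max_le_subinvariant (R : realType) (n : nat) (A : 'M[R]_n)
    (r : R) (v : 'I_n -> R) :
  (0 < n)%N -> (forall i j, 0 <= A i j) -> subinvariant A r v ->
  lambda_max A <= r.
Proof.
move=> n0 A0 Av; apply: ge_sup => [|x]; last exact: eigenvalue_le_subinvariant Av.
(* An upper bound controls [sup] only for a nonempty set, so a real eigenvalue must be exhibited. *)
by eexists; exact: (proj2 (inf_subinvariant_eigenvalue n0 A0)).
Qed.

Lemma subinvariant_near_lambda_max (R : realType) (n : nat) (A : 'M[R]_n)
    (e : R) :
  (0 < n)%N -> (forall i j, 0 <= A i j) -> 0 < e ->
  exists v, subinvariant A (lambda_max A + e) v.
Proof.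
move=> n0 A0 e0; have [hS ev] := inf_subinvariant_eigenvalue n0 A0.
have [s [v Av] sr] := inf_adherent e0 hS.
exists v => i; have [vi Avi] := Av i; split=> //; apply: (le_trans Avi).
rewrite ler_pM2r //; apply: (le_trans (ltW sr)); rewrite lerD2r.
apply: ub_le_sup ev.
by exists s => x; exact: eigenvalue_le_subinvariant Av.
Qed.

(** By concavity [ln] lies below its tangent at the weighted mean [S]; averaging the tangent values
    gives exactly [ln S]. *)
Lemma weighted_amgm (R : realType) (m : nat) (lambda x : 'I_m -> R) :
  weight_vector lambda -> (forall h, 0 < x h) ->
  \prod_h x h `^ lambda h <= \sum_h lambda h * x h.
Proof.
move=> [l0 l1] x0; set S := \sum_h _.
have S0 : 0 < S.
  have S_ge0 : 0 <= S by apply: sumr_ge0 => h _; rewrite mulr_ge0 // ltW.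
  rewrite lt_neqAle S_ge0 andbT eq_sym; apply/eqP => /psumr_eq0P S0.
  suff : \sum_h lambda h = 0 by rewrite l1; lra.
  apply: big1 => h _; apply/eqP.
  have /eqP := S0 (fun h _ => mulr_ge0 (l0 h) (ltW (x0 h))) h isT.
  by rewrite mulf_eq0 (gt_eqF (x0 h)) orbF.
have -> : \prod_h x h `^ lambda h = expR (\sum_h lambda h * ln (x h)).
  rewrite expR_sum; apply: eq_bigr => h _.
  by rewrite /powR gt_eqF.
rewrite -[leRHS]lnK ?posrE // ler_expR.
(* the tangent line of [ln] at [S] *)
have tangent h : ln (x h) <= ln S + (x h / S - 1).
  have -> : ln (x h) = ln S + ln (1 + (x h / S - 1)).
    by rewrite [1 + _]addrC subrK ln_div ?posrE // addrC subrK.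
  by rewrite lerD2l le_ln1Dx // ltrBrDr addNr divr_gt0.
apply: (@le_trans _ _ (\sum_h lambda h * (ln S + (x h / S - 1)))).
  by apply: ler_sum => h _; rewrite ler_wpM2l.
have -> : \sum_h lambda h * (ln S + (x h / S - 1))
        = (\sum_h lambda h) * (ln S - 1) + S / S.
  rewrite [in X in _ + X / _]/S !mulr_suml -big_split /=.
  by apply: eq_bigr => h _; ring.
by rewrite l1 divff ?gt_eqF // mul1r subrK.
Qed.

Lemma aggregate_subinvariant (R : realType) (m n : nat) (A : 'I_m -> 'M[R]_n)
    (lambda r : 'I_m -> R) (v : 'I_m -> 'I_n -> R) :
  weight_vector lambda -> (forall h i j, 0 < A h i j) ->
  (forall h, subinvariant (A h) (r h) (v h)) ->
  subinvariant (aggregate A lambda) (\sum_h lambda h * r h)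
    (fun i => \prod_h v h i `^ lambda h).
Proof.
move=> hl A0 Av i.
have v0 h j : 0 < v h j by case: (Av h j).
have w0 j : 0 < \prod_h v h j `^ lambda h.
  by apply: prodr_gt0 => h _; exact: powR_gt0.
split=> //; rewrite -ler_pdivrMr // mulr_suml.
apply: (@le_trans _ _
  (\sum_j \sum_h lambda h * (A h i j * v h j / v h i))).
  apply: ler_sum => j _; rewrite mxE.
  have q0 h : 0 < A h i j * v h j / v h i by rewrite divr_gt0 ?mulr_gt0.
  apply: le_trans (weighted_amgm hl q0).
  (* Equality holds here: real powers are multiplicative on positive bases, so the quotient splits
     over [h]. *)
  rewrite -prodfV -!big_split /= le_eqVlt; apply/orP; left; apply/eqP.
  apply: eq_bigr => h _.
  rewrite -powRN -powR_inv1 ?ltW //.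
  by rewrite !powRM ?mulr_ge0 ?powR_ge0 ?ltW // -powRrM mulN1r.
rewrite exchange_big /=; apply: ler_sum => h _.
rewrite -mulr_sumr ler_wpM2l //; first by case: hl.
by rewrite -mulr_suml ler_pdivrMr //; case: (Av h i).
Qed.

Theorem corollary3 (R : realType) (m n : nat) (hm : (2 <= m)%N) (hn : (2 < n)%N)
  (A : 'I_m -> 'M[R]_n) (hA : forall h : 'I_m, pairwise_comparison (A h))
  (lambda : 'I_m -> R) (hlambda : weight_vector lambda) :
  CI (aggregate A lambda) <= \sum_(h < m) lambda h * CI (A h).
Proof.
have n0 : (0 < n)%N by apply: leq_trans hn.
have A0 h i j : 0 < A h i j by case: (hA h i j).
have l1 : \sum_h lambda h = 1 by case: hlambda.
have -> : \sum_h lambda h * CI (A h)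
        = (\sum_h lambda h * lambda_max (A h) - n%:R) / (n%:R - 1).
  rewrite -[X in _ - X](mul1r n%:R) -[X in _ - X * _]l1 mulr_suml -sumrB.
  by rewrite mulr_suml; apply: eq_bigr => h _; rewrite /CI mulrA mulrBr.
rewrite /CI ler_wpM2r ?invr_ge0 ?subr_ge0 ?ler1n // lerD2r.
(* The same slack [e] is used for every [h]; as the weights sum to 1, it costs exactly [e] in
   total. *)
apply/ler_addgt0Pr => e e0.
have /choice[v Av] h := subinvariant_near_lambda_max n0
  (fun i j => ltW (A0 h i j)) e0.
have -> : \sum_h lambda h * lambda_max (A h) + e
        = \sum_h lambda h * (lambda_max (A h) + e).
  by under [RHS]eq_bigr do rewrite mulrDr; rewrite big_split -mulr_suml l1 mul1r.
apply: lambda_max_le_subinvariant n0 _ (aggregate_subinvariant hlambda A0 Av).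
by move=> i j; rewrite mxE prodr_ge0 // => h _; exact: powR_ge0.
Qed.
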